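(* Let $H$ be a real Hilbert space and let $\{A_t:H\rightrightarrows H,\ t\ge 0\}$ be a family of maximal monotone operators. Assume that there exists a maximal monotone operator $A_\infty:H\rightrightarrows H$ such that $S_\infty=A_\infty^{-1}(0)\neq\emptyset$ and $$\forall (z,p)\in \mathrm{gph}\,A_\infty,\qquad \int_0^{+\infty}G_{A_t}(z,p)\,dt<+\infty .$$ Then every strong global solution $x(\cdot)$ of $$\dot x(t)+A_t(x(t))\ni 0,\qquad t\ge 0,$$ converges weakly in average to some $x_\infty\in S_\infty$, i.e. there is $x_\infty\in S_\infty$ such that $$\frac1t\int_0^t x(s)\,ds\rightharpoonup x_\infty\quad\text{weakly in } H \text{ as } t\to+\infty .$$
   Context: $H$ is a real Hilbert space with scalar product $\langle\cdot,\cdot\rangle$ and norm $\|\cdot\|$. A multivalued operator $M:H\rightrightarrows H$ assigns to each $x\in H$ a set $Mx\subset H$; $\mathrm{gph}\,M=\{(x,u)\in H\times H: u\in Mx\}$, and $M^{-1}(0)=\{x: 0\in Mx\}$. $M$ is monotone if $\langle y-x,v-u\rangle\ge 0$ for all $(x,u),(y,v)\in\mathrm{gph}\,M$, and maximal monotone if no monotone operator has a graph strictly containing $\mathrm{gph}\,M$. The Brézis–Haraux function of $M$ is $G_M:H\times H\to\mathbb R\cup\{+\infty\}$, $G_M(x,u)=\sup_{(y,v)\in\mathrm{gph}\,M}\langle x-y,v-u\rangle$ (it is nonnegative when $M$ is maximal monotone). A strong global solution of $\dot x(t)+A_t(x(t))\ni0$ is a function $x:[0,+\infty[\to H$ that is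 absolutely continuous on every bounded interval $[0,T]$ and satisfies the inclusion for almost every $t>0$. *)

(* Defs.v *)
From HB Require Import structures.
From mathcomp Require Export all_boot all_order all_algebra sesquilinear.
From mathcomp Require Export all_classical all_reals all_analysis.
Export Order.TTheory GRing.Theory Num.Theory.
Export numFieldNormedType.Exports.

Set Implicit Arguments.
Unset Strict Implicit.
Unset Printing Implicit Defensive.

Local Open Scope classical_set_scope.
Local Open Scope ring_scope.

(* A real Hilbert space is a complete normed space H over R together with a
   positive definite symmetric bilinear form that induces the norm of H. *)
Definition induces_norm (R : realType) (H : normedModType R)
    (dot : {dot H for (@idfun R)}) : Prop :=
  forall x : H, `|x| ^+ 2 = dot x x.

Section Operators.
Context (R : realType) (H : completeNormedModType R).
Variable dot : {dot H for (@idfun R)}.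
Implicit Types (M N : H -> set H) (x u : H).

Definition gph M : set (H * H) := [set xu | M xu.1 xu.2].

Definition zeros M : set H := [set x | M x 0].

Definition monotone_op M : Prop := forall xu yv : H * H,
  gph M xu -> gph M yv -> 0 <= dot (yv.1 - xu.1) (yv.2 - xu.2).

Definition maximal_monotone M : Prop :=
  monotone_op M /\ forall N, monotone_op N -> ~ (gph M `<` gph N).

(* Valued in the extended reals; -oo arises only when gph M is empty, which
   maximal monotonicity excludes. *)
Definition brezis_haraux M x u : \bar R :=
  ereal_sup [set (dot (x - yv.1) (yv.2 - u))%:E | yv in gph M].

End Operators.

Section BochnerIntegral.
Context (R : realType) (H : completeNormedModType R).
Context (d : measure_display) (T : measurableType d).
Variable mu : {measure set T -> \bar R}.

(* The cells need not be disjoint: the associated function is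
   t |-> \sum_i \1_(cell i) t *: value i. *)
Record simple_map := SimpleMap {
  simple_size : nat;
  simple_cell : 'I_simple_size -> set T;
  simple_value : 'I_simple_size -> H;
  simple_measurable : forall i, measurable (simple_cell i);
  simple_finite : forall i, (mu (simple_cell i) < +oo)%E }.

Definition simple_fun (s : simple_map) (t : T) : H :=
  \sum_i (\1_(@simple_cell s i) t : R) *: @simple_value s i.

Definition simple_integral (D : set T) (s : simple_map) : H :=
  \sum_i fine (mu (@simple_cell s i `&` D)) *: @simple_value s i.

(* The almost everywhere convergence expresses the strong measurability of f
   on D. *)
Definition is_bochner_integral (D : set T) (f : T -> H) (I : H) : Prop :=
  exists s : nat -> simple_map,
    [/\ {ae mu, forall t, D t -> simple_fun (s n) t @[n --> \oo] --> f t},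
        (\int[mu]_(t in D) `|f t - simple_fun (s n) t|%:E)%E
          @[n --> \oo] --> 0%E
      & simple_integral D (s n) @[n --> \oo] --> I].

(* Total: 0 if f is not Bochner integrable on D. *)
Definition bochner_integral (D : set T) (f : T -> H) : H :=
  xget 0 [set I | is_bochner_integral D f I].

End BochnerIntegral.

Section Evolution.
Context (R : realType) (H : completeNormedModType R).

Definition absolutely_continuous_on (a b : R) (f : R -> H) : Prop :=
  forall e : R, 0 < e -> exists2 delta : R, 0 < delta &
    forall (n : nat) (u v : 'I_n -> R),
      (forall i, a <= u i /\ u i <= v i /\ v i <= b) ->
      (forall i j, i != j -> `]u i, v i[ `&` `]u j, v j[ = set0) ->
      \sum_i (v i - u i) < delta ->
      \sum_i `|f (v i) - f (u i)| < e.

(* Only the values of x and A on [0, +oo[ matter.  Derivability is recorded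
   because derive1 x t is defined even where x is not derivable; almost everywhere
   it follows from absolute continuity, H being a Hilbert space. *)
Definition strong_global_solution (A : R -> H -> set H) (x : R -> H) : Prop :=
  (forall T : R, 0 <= T -> absolutely_continuous_on 0 T x) /\
  {ae (@lebesgue_measure R), forall t : R, 0 < t ->
     derivable x t 1 /\ exists2 u, A t (x t) u & derive1 x t + u = 0}.

Definition time_average (x : R -> H) (t : R) : H :=
  t^-1 *: bochner_integral (@lebesgue_measure R) `[0, t] x.

(* Convergence in the topology sigma(H, H'), H' the topological dual. *)
Definition weakly_cvg_pinfty (y : R -> H) (l : H) : Prop :=
  forall phi : {linear H -> R^o}, continuous phi ->
    phi (y t) @[t --> +oo] --> phi l.

End Evolution.

(* Main.v *)
Require Import Defs.
From mathcomp Require Import ring lra measurable_realfun.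

(** Write X t for the average of x over [0, t] and let (z, p) be in the graph
of Ainf.  Almost everywhere - x' belongs to A_t (x), so that taking the pair
(x, - x') in the supremum that defines the Brezis-Haraux function gives

  <x - z, x' + p> <= G_{A_t} (z, p).

The left-hand side is the derivative of the energy
|x - z|^2 / 2 + \int_0^t <x - z, p>.  As the right-hand side is integrable, the
energy is bounded above ([energy_bounded]); dividing by t gives
<X t - z, p> <= C / t.  A weak cluster point l of X thus satisfies
<l - z, p> <= 0 for all (z, p) in the graph of Ainf, which by maximality means
that l is a zero of Ainf ([average_cluster_zero]).

When p = 0 the energy is |x - z|^2 / 2 and it even converges: it is
bounded below and its derivative has an integrable positive part
([distance_to_zeros_cvg]).  Comparing two zeros a and b, <x, a - b> converges,
hence so does its Cesaro mean <X, a - b> ([average_dot_diff_cvg]).  If a and b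
are both weak cluster points of X, then <a, a - b> = <b, a - b>, i.e. a = b.
Since X is bounded, uniqueness of the cluster point is weak convergence
([weak_cvg_unique_cluster]); this is the argument of Opial and Passty.

Three ingredients need work.

Integrating the differential inequality ([integrable_majorant]).  The function
t |-> G_{A_t} (z, p) may fail to be measurable; the integral of a nonnegative
function is then the supremum of the integrals of the simple functions below
it, so it still dominates the integral of every measurable minorant.  This
applies to the positive part g of the derivative of the energy.  The energy
minus the primitive of g has a nonpositive derivative almost everywhere, and
an absolutely continuous function with that property is nonincreasing
([ae_derivative_le0_nonincreasing], by a covering argument).

Weak compactness.  Along an ultrafilter every bounded real function converges,
so a bounded family of vectors defines a bounded linear form, represented by a
vector thanks to the Riesz theorem ([riesz], [ultra_weak_cvg]).

The Bochner integral.  It commutes with y |-> <y, p> ([dot_bochner]) and exists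
for functions that are uniformly continuous on a segment
([uniformly_continuous_bochner]); from then on only real integrals appear. *)

Set Implicit Arguments.
Unset Strict Implicit.
Unset Printing Implicit Defensive.

Local Open Scope classical_set_scope.
Local Open Scope ring_scope.

(** * Geometry of a Hilbert space and weak convergence *)

Lemma cvg_dist_squeeze (R : realType) (V : normedModType R) T
    (F : set_system T) (FF : Filter F) (f : T -> V) (l : V) (g : T -> R) :
  (forall t, `|f t - l| <= g t) -> g t @[t --> F] --> 0 ->
  f t @[t --> F] --> l.
Proof.
move=> fg /cvgrPdist_lt g0; apply/cvgrPdist_lt => e e0.
apply: filterS (g0 _ e0) => t; rewrite sub0r normrN distrC.
by apply: le_lt_trans; rewrite (le_trans (fg t))// ler_norm.
Qed.

Section HilbertGeometry.
Context (R : realType) (H : completeNormedModType R).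
Variables (dot : {dot H for (@idfun R)}) (hdot : induces_norm dot).

Lemma dotC (x y : H) : dot x y = dot y x.
Proof. by rewrite hermC expr0 mul1r. Qed.

Lemma dotZl (a : R) (x y : H) : dot (a *: x) y = a * dot x y.
Proof. exact: linearZl_LR. Qed.

Lemma dotZr (a : R) (x y : H) : dot x (a *: y) = a * dot x y.
Proof. exact: linearZr_LR. Qed.

Lemma norm_sqrD (x y : H) : `|x + y| ^+ 2 = `|x| ^+ 2 + 2 * dot x y + `|y| ^+ 2.
Proof. by rewrite !hdot linearDl linearDr /= linearDr /= (dotC y x); ring. Qed.

Lemma norm_sqrB (x y : H) : `|x - y| ^+ 2 = `|x| ^+ 2 - 2 * dot x y + `|y| ^+ 2.
Proof. by rewrite norm_sqrD normrN linearNr /=; ring. Qed.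

Lemma parallelogram (x y : H) :
  `|x + y| ^+ 2 + `|x - y| ^+ 2 = 2 * (`|x| ^+ 2 + `|y| ^+ 2).
Proof. by rewrite norm_sqrD norm_sqrB; ring. Qed.

(** For nonzero u and v, expanding the nonnegative square of the norm of
|v| u - |u| v and dividing by 2 |u| |v| gives <u, v> <= |u| |v|. *)
Lemma cauchy_schwarz (x y : H) : `|dot x y| <= `|x| * `|y|.
Proof.
have dle u v : dot u v <= `|u| * `|v|.
  have [->|u0] := eqVneq u 0; first by rewrite linear0l normr0 mul0r.
  have [->|v0] := eqVneq v 0; first by rewrite linear0r normr0 mulr0.
  have := sqr_ge0 `| `|v| *: u - `|u| *: v|.
  rewrite norm_sqrB dotZl dotZr !normrZ !normr_id.
  have : 0 < `|u| * `|v| by rewrite mulr_gt0 ?normr_gt0.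
  move: (`|u|) (`|v|) (dot u v) => p q d pq h.
  rewrite -(ler_pM2l pq); lra.
rewrite ler_norml dle andbT lerNl -(normrN x).
by have := dle (- x) y; rewrite linearNl.
Qed.

Lemma cvg_dot T (F : set_system T) {FF : Filter F} (f g : T -> H) (a b : H) :
  f t @[t --> F] --> a -> g t @[t --> F] --> b ->
  dot (f t) (g t) @[t --> F] --> dot a b.
Proof.
move=> fa gb.
have fa0 : `|f t - a| @[t --> F] --> 0 by apply/norm_cvg0P/subr_cvg0.
have gb0 : `|g t - b| @[t --> F] --> 0 by apply/norm_cvg0P/subr_cvg0.
apply: (@cvg_dist_squeeze _ R^o _ _ _ _ _ (fun t => `|f t - a| * `|g t - b| + `|a| * `|g t - b| +
  `|f t - a| * `|b|)).
  move=> t; rewrite (_ : _ - _ = dot (f t - a) (g t - b) + dot a (g t - b) +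
    dot (f t - a) b); last by rewrite !(linearBl, linearBr) /=; ring.
  rewrite (le_trans (ler_normD _ _))// lerD ?cauchy_schwarz//.
  by rewrite (le_trans (ler_normD _ _))// lerD ?cauchy_schwarz.
rewrite -[X in _ --> X]addr0 -[X in _ --> X + _]addr0.
apply: cvgD; first apply: cvgD.
- by rewrite -[X in _ --> X](mulr0 0); exact: cvgM.
- by rewrite -[X in _ --> X](mulr0 `|a|); apply: cvgM gb0; exact: cvg_cst.
- by rewrite -[X in _ --> X](mul0r `|b|); apply: cvgM fa0 _; exact: cvg_cst.
Qed.

(** The representing vector is the minimiser of |y|^2 - 2 phi y: a minimising
sequence is Cauchy by the parallelogram identity, and the first-order
condition at the minimum reads phi y = <r, y>. *)
Lemma riesz (phi : H -> R) (C : R)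
    (phiP : forall a y z, phi (a *: y + z) = a * phi y + phi z)
    (phiC : forall y, `|phi y| <= C * `|y|) :
  exists r, forall y, phi y = dot r y.
Proof.
have C0 (y : H) : 2 * phi y <= C ^+ 2 + `|y| ^+ 2.
  have := phiC y; rewrite ler_norml => /andP[_ py].
  have := sqr_ge0 (C - `|y|); rewrite sqrrB mulr2n; lra.
pose J (y : H) : R := `|y| ^+ 2 - 2 * phi y.
have phiD y z : phi (y + z) = phi y + phi z by rewrite -{1}[y]scale1r phiP mul1r.
have phi0 : phi 0 = 0.
  by have := phiD 0 0; rewrite addr0; lra.
have phiZ a y : phi (a *: y) = a * phi y by rewrite -[_ *: _]addr0 phiP phi0 addr0.
have Jlb : has_inf (range J).
  split; first by exists (J 0), 0.
  exists (- C ^+ 2) => _ [y _ <-]; rewrite /J; have := C0 y; lra.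
pose m := inf (range J).
have mJ y : m <= J y by apply: ge_inf; [exact: Jlb.2|exists y].
have /choice[u uJ] : forall n : nat, exists y, J y < m + n.+1%:R^-1.
  move=> n; have /(inf_adherent)/(_ Jlb)[_ [y _ <-] ylt] : (0 : R) < n.+1%:R^-1.
    by rewrite invr_gt0.
  by exists y.
have Jdist y z : `|y - z| ^+ 2 <= 2 * (J y - m) + 2 * (J z - m).
  have := parallelogram y z; have := mJ (2^-1 *: (y + z)).
  rewrite /J normrZ phiZ phiD exprMn ger0_norm//.
  set p := `|y + z| ^+ 2; set q := `|y - z| ^+ 2; rewrite exprVn => h1 h2.
  have : 4 * m <= p - 4 * (phi y + phi z) by move: h1; lra.
  lra.
have ucvg : cvg (u n @[n --> \oo]).
  apply/cauchy_cvgP/cauchy_exP => e e0.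
  have e2 : 0 < e ^+ 2 / 4 by rewrite divr_gt0 ?exprn_gt0.
  have [N _ HN] : \forall n \near \oo, n.+1%:R^-1 < e ^+ 2 / 4.
    have := @cvg_harmonic R => /cvgrPdist_lt /(_ _ e2); apply: filterS => n.
    by rewrite sub0r normrN ger0_norm// /harmonic invr_ge0.
  exists (u N); exists N => // n Nn; rewrite /= -ball_normE /=.
  rewrite -(ltr_pXn2r (n := 2)) ?nnegrE ?(ltW e0)//.
  apply: le_lt_trans (Jdist _ _) _.
  have := uJ N; have := uJ n; have := HN N (leqnn _); have := HN n Nn => /=.
  by move: (n.+1%:R^-1) (N.+1%:R^-1) (J (u n)) (J (u N)) => p q v w; lra.
pose r := lim (u n @[n --> \oo]).
have {}ucvg : u n @[n --> \oo] --> r by exact: ucvg.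
have Jr : J r = m.
  apply/eqP; rewrite eq_le mJ andbT.
  have phic : phi (u n) @[n --> \oo] --> phi r.
    apply: (@cvg_dist_squeeze _ R^o _ _ _ _ _ (fun n => C * `|u n - r|)).
      by move=> n; rewrite -mulN1r -phiZ scaleN1r -phiD.
    rewrite -(mulr0 C); apply: cvgM; first exact: cvg_cst.
    by apply/norm_cvg0P/subr_cvg0.
  have Jc : J (u n) @[n --> \oo] --> J r.
    apply: cvgB; last by apply: cvgM; [exact: cvg_cst|].
    by rewrite expr2; apply: cvgM; apply: cvg_norm.
  rewrite -[leRHS]addr0; apply: ler_cvg_to Jc _ _.
    by apply: cvgD; [exact: cvg_cst|exact: cvg_harmonic].
  by apply: nearW => n; exact: ltW.
exists r => y.
(* J is minimal at r: its increment in the direction t y is nonnegative. *)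
have quad t : 0 <= 2 * t * (dot r y - phi y) + t ^+ 2 * `|y| ^+ 2.
  have := mJ (r + t *: y); rewrite -Jr /J norm_sqrD dotZr phiD phiZ normrZ.
  rewrite exprMn real_normK ?num_real//; lra.
(* The increment is quadratic in t with nonnegative leading coefficient |y|^2;
   this value of t makes it negative unless the linear coefficient is 0. *)
have := quad ((phi y - dot r y) / (1 + `|y| ^+ 2)).
set c := `|y| ^+ 2; have c0 : 0 <= c by exact: sqr_ge0.
set b := phi y - dot r y.
have -> : dot r y - phi y = - b by rewrite opprB.
have c1 : 0 < 1 + c by lra.
have -> : 2 * (b / (1 + c)) * - b + (b / (1 + c)) ^+ 2 * c =
   - (b ^+ 2 * (2 + c) / (1 + c) ^+ 2) by field; lra.
rewrite oppr_ge0 pmulr_lle0 ?invr_gt0 ?exprn_gt0// pmulr_lle0; last lra.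
by move=> b0; apply/eqP; rewrite -subr_eq0 -/b -sqrf_eq0 eq_le b0 sqr_ge0.
Qed.

Lemma ultra_bounded_cvg T (U : set_system T) (UU : UltraFilter U)
    (f : T -> R) (K : R) :
  (\forall t \near U, `|f t| <= K) -> exists2 c, `|c| <= K & f t @[t --> U] --> c.
Proof.
move=> fK; have := @segment_compact R (- K) K => /(_ (f @ U) _).
case=> [|c []].
  by apply: filterS fK => t; rewrite /= in_itv/= ler_norml.
rewrite /= in_itv/= -ler_norml => cK clc; exists c => // B cB.
have [//|UnB] := in_ultra_setVsetC (f @^-1` B) UU.
by have [x []] := clc (~` B) B UnB cB.
Qed.

(** Weak compactness of balls.  The limits along U of the real functions
<X t, y> depend linearly on y and are bounded by K |y|, so they are
represented by a vector. *)
Lemma ultra_weak_cvg T (U : set_system T) (UU : UltraFilter U) (X : T -> H) (K : R) :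
  (\forall t \near U, `|X t| <= K) ->
  exists l, forall y, dot (X t) y @[t --> U] --> dot l y.
Proof.
move=> XK.
have /choice[L LP] : forall y, exists c, `|c| <= K * `|y| /\ dot (X t) y @[t --> U] --> c.
  move=> y; have [|c cK cP] := @ultra_bounded_cvg T U UU (fun t => dot (X t) y) (K * `|y|).
    apply: filterS XK => t XtK; apply: le_trans (cauchy_schwarz _ _) _.
    by rewrite ler_wpM2r.
  by exists c.
have Llin a y z : L (a *: y + z) = a * L y + L z.
  apply: (cvg_unique (@Rhausdorff R) (LP _).2).
  rewrite (_ : (fun t => _) = (fun t => a * dot (X t) y + dot (X t) z)); last first.
    by apply/funext => t; rewrite linearDr /= dotZr.
  by apply: cvgD; [apply: cvgM; [exact: cvg_cst|exact: (LP y).2]|exact: (LP z).2].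
have [l lP] := riesz Llin (fun y => (LP y).1).
by exists l => y; rewrite -lP; exact: (LP y).2.
Qed.

(** Weak cluster points are the weak limits along the ultrafilters finer than F.
If l and l' are two of them, then both <l, l - l'> and <l', l - l'> are the limit
of <X, l - l'> along F, so |l - l'|^2 = 0.  A failure of convergence to l
would be recorded by some ultrafilter, whose weak limit would differ from l. *)
Lemma weak_cvg_unique_cluster T (F : set_system T) (FF : ProperFilter F)
    (X : T -> H) (K : R) (S : set H) :
  (\forall t \near F, `|X t| <= K) ->
  (forall (U : set_system T) l, UltraFilter U -> F `<=` U ->
     (forall y, dot (X t) y @[t --> U] --> dot l y) -> S l) ->
  (forall a b, S a -> S b -> exists c : R, dot (X t) (a - b) @[t --> F] --> c) ->
  exists2 l, S l & forall y, dot (X t) y @[t --> F] --> dot l y.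
Proof.
move=> XK XS Xdiff.
have [U [UU FU]] := ultraFilterLemma FF.
have [l lP] := @ultra_weak_cvg T U UU X K (FU _ XK).
have Sl := XS U l UU FU lP; exists l => // y.
apply/cvgrPdist_lt => e e0; apply: contrapT => nF.
pose B := [set t | e <= `|dot l y - dot (X t) y|].
(* An ultrafilter finer than F that contains the bad set B. *)
have BF : ProperFilter (within B F).
  apply: Build_ProperFilter => FB; apply: nF.
  move: FB; rewrite /within /=; apply: filterS => t BPt.
  by rewrite ltNge; apply/negP => /BPt.
have [V [VV BV]] := ultraFilterLemma BF.
have FV : F `<=` V.
  by move=> P FP; apply: BV; apply: filterS FP.
have [l' l'P] := @ultra_weak_cvg T V VV X K (FV _ XK).
have Sl' := XS V l' VV FV l'P.
have [c cP] := Xdiff l l' Sl Sl'.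
have ll' : l = l'.
  have e1 : dot l (l - l') = c.
    by apply: (cvg_unique (@Rhausdorff R) (lP _)); apply: cvg_trans cP; exact: cvg_app.
  have e2 : dot l' (l - l') = c.
    by apply: (cvg_unique (@Rhausdorff R) (l'P _)); apply: cvg_trans cP; exact: cvg_app.
  apply/eqP; rewrite -subr_eq0 -normr_eq0 -sqrf_eq0 hdot linearBl /= e1 e2.
  by rewrite subrr.
move: l'P; rewrite -ll' => /(_ y)/cvgrPdist_lt/(_ _ e0) Vlt.
have VB : V B by apply: BV; exact: withinT.
have [t []] := filter_ex (filterI Vlt VB).
by rewrite /B /= leNgt => ->.
Qed.

End HilbertGeometry.

(** * Functions whose derivative is almost everywhere dominated *)

Section LowerIntegral.
Import HBNNSimple.

(** The integral of a nonnegative function is by definition the supremum of the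
integrals of the nonnegative simple functions below it, a quantity that is
monotone in the integrand, measurable or not. *)
Lemma le_lower_integral d (T : measurableType d) (R : realType)
    (mu : {measure set T -> \bar R}) (D : set T) (f g : T -> \bar R) :
  (forall t, D t -> (0 <= f t)%E) -> (forall t, D t -> (f t <= g t)%E) ->
  (\int[mu]_(t in D) f t <= \int[mu]_(t in D) g t)%E.
Proof.
move=> f0 fg.
have g0 t : D t -> (0 <= g t)%E by move=> Dt; exact: le_trans (f0 t Dt) (fg t Dt).
rewrite !ge0_integralE//; apply: ereal_sup_le => _ [h hf <-].
exists h => // t; apply: le_trans (hf t) _.
rewrite /patch; case: ifPn => // /set_mem; exact: fg.
Qed.

End LowerIntegral.

Lemma cvg_difference_quotient (R : realType) (V : normedModType R) (f : R -> V)
    (t : R) : derivable f t 1 ->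
  h^-1 *: (f (t + h) - f t) @[h --> 0^'] --> derive1 f t.
Proof.
rewrite derive1E /derivable /derive => df.
rewrite (_ : (fun h => _) = (fun h => h^-1 *: ((f \o shift t) (h *: 1) - f t)))//.
by apply/funext => h /=; rewrite /shift /= (addrC t) [h *: 1]mulr1.
Qed.

Lemma derivable_from_quotient (R : realType) (V : normedModType R) (f : R -> V) (t : R) (l : V) :
  h^-1 *: (f (t + h) - f t) @[h --> 0^'] --> l ->
  derivable f t 1 /\ derive1 f t = l.
Proof.
move=> fl.
have fl' : h^-1 *: ((f \o shift t) (h *: 1) - f t) @[h --> 0^'] --> l.
  move: fl; rewrite (_ : (fun h => _) = (fun h => h^-1 *: ((f \o shift t) (h *: 1) - f t)))//.
  by apply/funext => h /=; rewrite /shift /= (addrC t) [h *: 1]mulr1.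
split; first by apply/cvg_ex; exists l.
by rewrite derive1E; apply/cvg_lim.
Qed.

Section Nonincreasing.
Context (R : realType).
Notation mu := (@lebesgue_measure R).

(** Cover the null set of bad points by an open set W of small measure.  The
increment of f over an interval in W is controlled by absolute continuity,
while near a point outside W the slope of f is at most e.  A supremum argument
chains these two kinds of steps from a to b, giving
f b - f a <= e (b - a) + e for every e > 0.

Only an upper bound on the increments is required, so the hypothesis holds for
the difference of an absolutely continuous function and a nondecreasing one. *)
Lemma ae_derivative_le0_nonincreasing (a b : R) (f : R -> R) :
  a <= b ->
  (forall e, 0 < e -> exists2 delta, 0 < delta &
    forall (n : nat) (u v : 'I_n -> R),
      (forall i, a <= u i /\ u i <= v i /\ v i <= b) ->
      (forall i j, i != j -> `]u i, v i[ `&` `]u j, v j[ = set0) ->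
      \sum_i (v i - u i) < delta -> \sum_i (f (v i) - f (u i)) < e) ->
  {ae mu, forall t, a < t -> t < b -> derivable f t 1 /\ derive1 f t <= 0} ->
  f b <= f a.
Proof.
move=> ab fac [N0 [mN0 N00 N0P]].
apply/ler_addgt0Pr => e0 e00.
(* The total loss will be e (b - a) from the flat steps plus e from W. *)
pose e := e0 / (1 + (b - a)).
have e_gt0 : 0 < e by rewrite divr_gt0//; lra.
have [dl dl0 fd] := fac _ e_gt0.
(* The endpoints are counted as bad, f being differentiable inside only. *)
pose N := N0 `|` ([set a] `|` [set b]).
have mN : measurable N by do 2 apply: measurableU => //.
have N_0 : mu N = 0%E.
  have ab0 : mu ([set a] `|` [set b]) = 0%E.
    by rewrite measureU0//; exact: lebesgue_measure_set1.
  by rewrite measureU0//; exact: measurableU.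
have [W [oW NW muW]] : exists W : set R, [/\ open W, N `<=` W & (mu W < dl%:E)%E].
  have muN : (mu N < +oo)%E by rewrite N_0.
  have [W [oW NW WN]] := lebesgue_regularity_outer mN muN dl0.
  exists W; split => //.
  have mW : measurable W by exact: open_measurable.
  by rewrite -(setDUK NW) setUC measureU0//; exact: measurableD.
have mW : measurable W by exact: open_measurable.
(* The point s is reachable if the increment of f from a to s is at most
   e (s - a), up to the increments over disjoint intervals whose total length
   is at most the measure of the part of W on the left of s. *)
pose reach s := exists (n : nat) (u v : 'I_n -> R),
  [/\ forall i, a <= u i /\ u i <= v i /\ v i <= s,
      forall i j, i != j -> `]u i, v i[ `&` `]u j, v j[ = set0,
      ((\sum_i (v i - u i))%:E <= mu (W `&` `[a, s[))%E &
      f s - f a <= e * (s - a) + \sum_i (f (v i) - f (u i))].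
have reacha : reach a.
  exists 0%N, (fun=> a), (fun=> a); split => //.
  - by case.
  - by rewrite big_ord0.
  - by rewrite big_ord0 !subrr mulr0 addr0.
have reach_flat s s' : s <= s' -> reach s -> f s' - f s <= e * (s' - s) -> reach s'.
  move=> ss' [n [u [v [uv dis sm fs]]]] fss'; exists n, u, v; split => //.
  - by move=> i; have [? []] := uv i; split=> //; split=> //; lra.
  - apply: le_trans sm _; apply: le_measure.
    + by rewrite inE; apply: measurableI.
    + by rewrite inE; apply: measurableI.
    + apply: setIS => t /=; rewrite !in_itv/=; lra.
  - lra.
have reach_cover s s' : a <= s -> s <= s' -> `[s, s'[ `<=` W -> reach s -> reach s'.
  move=> as_ ss' sW [n [u [v [uv dis sm fs]]]].
  pose ext (w : 'I_n -> R) c (i : 'I_n.+1) := if unlift ord0 i is Some j then w j else c.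
  have ext0 w c : ext w c ord0 = c by rewrite /ext unlift_none.
  have extS w c j : ext w c (lift ord0 j) = w j by rewrite /ext liftK.
  have away k : `]s, s'[ `&` `]u k, v k[ = set0.
    rewrite -subset0 => x [] /=; rewrite !in_itv/=.
    have [_ []] := uv k; lra.
  exists n.+1, (ext u s), (ext v s'); split.
  - move=> i; case: (unliftP ord0 i) => [j ->|->]; rewrite ?extS ?ext0//.
    by have [? []] := uv j; split=> //; split=> //; lra.
  - move=> i j; case: (unliftP ord0 i) => [k ->|->]; case: (unliftP ord0 j) => [l ->|->];
      rewrite ?extS ?ext0 ?eqxx//.
    + by rewrite (inj_eq lift_inj); exact: dis.
    + by move=> _; rewrite setIC.
  - rewrite big_ord_recl !ext0; under eq_bigr do rewrite !extS.
    have -> : (s' - s + \sum_i (v i - u i))%:E = (mu `[s, s'[ + (\sum_i (v i - u i))%:E)%E.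
      rewrite lebesgue_measure_itv/= lte_fin EFinD; case: ltP => // ss.
      by have -> : s' = s by [lra]; rewrite subrr.
    apply: (@le_trans _ _ (mu (`[s, s'[ `|` (W `&` `[a, s[)))).
      rewrite measureU//; first by rewrite leeD2l.
      - exact: measurableI.
      - by rewrite -subset0 => x [] /=; rewrite !in_itv/= => ? [_]; lra.
    apply: le_measure; rewrite ?inE.
    + by apply: measurableU => //; exact: measurableI.
    + exact: measurableI.
    + move=> x [xs|[Ox xs]]; split => //.
      * exact: sW.
      * by move: xs; rewrite /= !in_itv/=; lra.
      * by move: xs; rewrite /= !in_itv/=; lra.
  - rewrite big_ord_recl !ext0; under eq_bigr do rewrite !extS.
    have : 0 <= e * (s' - s) by rewrite mulr_ge0 ?subr_ge0// ltW.
    lra.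
(* Around every t one can jump from any reachable s <= t to any s' >= t: over
   an interval of W if t is in W, by the bound on the derivative otherwise. *)
have local t : a <= t -> t <= b -> exists2 r, 0 < r & forall s s', a <= s -> s' <= b ->
    t - r < s -> s <= t -> t <= s' -> s' < t + r -> reach s -> reach s'.
  move=> at_ tb; have [Wt|nWt] := pselect (W t).
    have /nbhs_ballP[r /= r0 rW] : nbhs t W by exact: open_nbhs_nbhs.
    exists r => // s s' as_ s'b ts st ts' s't; apply: reach_cover => //; first lra.
    move=> x /=; rewrite in_itv/= => xs; apply: rW; rewrite /ball/= ltr_distl; lra.
  have nNt : ~ N t by move/NW.
  have [at' tb'] : a < t /\ t < b.
    rewrite !lt_neqAle at_ tb !andbT; split; apply/eqP => tE; apply: nNt; right.
      by left; rewrite /= tE.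
    by right.
  have [df df0] : derivable f t 1 /\ derive1 f t <= 0.
    by apply: contrapT => nd; apply: nNt; left; apply: N0P => /(_ at' tb').
  have : \forall h \near 0^', h^-1 * (f (t + h) - f t) < e.
    apply: (cvgr_lt (derive1 f t)); last exact: le_lt_trans df0 e_gt0.
    exact: cvg_difference_quotient.
  rewrite near_withinE => /nbhs_ballP[r /= r0 rP].
  exists r => // s s' as_ s'b ts st ts' s't rs; apply: (reach_flat s) => //; first lra.
  have left_s : f t - f s <= e * (t - s).
    move: st; rewrite le_eqVlt => /predU1P[->|st]; first by rewrite !subrr mulr0.
    have : (s - t)^-1 * (f (t + (s - t)) - f t) < e.
      by apply: rP; [rewrite /ball /= sub0r normrN ltr_distl; lra|rewrite subr_eq0 lt_eqF].
    by rewrite (addrC t) subrK ltr_ndivrMl ?subr_lt0//; lra.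
  have right_s : f s' - f t <= e * (s' - t).
    move: ts'; rewrite le_eqVlt => /predU1P[->|ts']; first by rewrite !subrr mulr0.
    have : (s' - t)^-1 * (f (t + (s' - t)) - f t) < e.
      by apply: rP; [rewrite /ball /= sub0r normrN ltr_distl; lra|rewrite subr_eq0 gt_eqF].
    by rewrite (addrC t) subrK ltr_pdivrMl ?subr_gt0//; lra.
  lra.
pose S := [set s | a <= s <= b /\ reach s].
have S_sup : has_sup S.
  split; first by exists a; split => //; rewrite lexx.
  by exists b => s [/andP[]].
pose t := sup S.
have at_ : a <= t by apply: ub_le_sup; [exact: S_sup.2|split => //; rewrite lexx].
have tb : t <= b by apply: ge_sup => [|s [/andP[]]//]; exact: S_sup.1.
have [r r0 rP] := local t at_ tb.
have [s [/andP[as_ sb] rs] ts] := sup_adherent r0 S_sup.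
have st : s <= t by apply: ub_le_sup; [exact: S_sup.2|split => //; rewrite as_].
(* Jumping over the supremum t would contradict it, unless t = b. *)
pose s' := Num.min b (t + r / 2).
have s'b : s' <= b by rewrite ge_min lexx.
have ts' : t <= s' by rewrite le_min tb/=; lra.
have rs' : reach s'.
  apply: rP rs => //; rewrite gt_min; apply/orP; right; lra.
have s't : s' <= t.
  by apply: ub_le_sup; [exact: S_sup.2|split => //; rewrite s'b andbT; lra].
have tb' : b = t.
  move: s't; rewrite ge_min => /orP[bt|]; last lra.
  by apply/eqP; rewrite eq_le bt.
have [n [u [v [uv dis sm fs]]]] : reach b.
  by rewrite tb' (_ : t = s')//; apply/eqP; rewrite eq_le ts'.
have /fd : \sum_i (v i - u i) < dl.
  rewrite -lte_fin; apply: le_lt_trans sm _; apply: le_lt_trans muW.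
  by apply: le_measure; rewrite ?inE//; exact: measurableI.
move=> /(_ uv dis) h.
have eE : e * (1 + (b - a)) = e0 by rewrite /e divfK//; lra.
lra.
Qed.
End Nonincreasing.

Section Majorant.
Context (R : realType).
Notation mu := (@lebesgue_measure R).

(** It is the pointwise limit of the difference quotients with increments
1 / (n + 1). *)
Lemma measurable_derive1 (a : R -> R) (D : set R) : continuous a ->
  (forall t, D t -> derivable a t 1) -> measurable_fun D (derive1 a).
Proof.
move=> ac da; apply: (@measurable_fun_cvg _ _ _ D
  (fun n t => n.+1%:R * (a (t + n.+1%:R^-1) - a t))).
  move=> n; apply: (measurable_funS (E := setT)) => //.
  apply: continuous_measurable_fun => t; apply: cvgM; first exact: cvg_cst.
  apply: cvgB; last exact: ac.
  apply: (@cvg_comp _ _ _ (fun t => t + n.+1%:R^-1) a _ (nbhs (t + n.+1%:R^-1))); last exact: ac.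
  by apply: cvgD; [exact: cvg_id|exact: cvg_cst].
move=> t Dt.
have hn : n.+1%:R^-1 @[n --> \oo] --> (0 : R)^'.
  move=> B [e /= e0 eB].
  have /cvgrPdist_lt/(_ _ e0) := @cvg_harmonic R; apply: filterS => n hn.
  by apply: eB; [exact: hn|rewrite invr_eq0 pnatr_eq0].
have := cvg_comp _ _ hn (cvg_difference_quotient (da t Dt)).
apply: cvg_trans; apply: near_eq_cvg; apply: nearW => n /=.
by rewrite invrK.
Qed.

Lemma nondecreasing_halfline_cvg (f : R -> R) (m : R) :
  (forall s t, 0 <= s -> s <= t -> f s <= f t) -> (forall t, 0 <= t -> f t <= m) ->
  exists c : R, f t @[t --> +oo] --> c.
Proof.
move=> fmono fm; pose g t := f (Num.max 0 t).
have gmono : {homo g : s t / s <= t}.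
  move=> s t st; apply: fmono; first by rewrite le_max lexx.
  by rewrite ge_max !le_max lexx st orbT.
have gm : has_ubound (range g).
  by exists m => _ [t _ <-]; apply: fm; rewrite le_max lexx.
exists (sup (range g)); apply: cvg_trans (nondecreasing_cvgr gmono gm).
apply: near_eq_cvg; exists 0; split => // t t0.
by rewrite /g max_r// ltW.
Qed.

(** The majorant F is the primitive of the positive part g of the derivative of
a.  By Lebesgue differentiation the derivative of F is g almost everywhere, so
a - F has a nonpositive derivative almost everywhere; and the integral of the
measurable function g is bounded by the lower integral of G. *)
Lemma integrable_majorant (a : R -> R) (G : R -> \bar R) :
  continuous a ->
  (forall T, 0 <= T -> @absolutely_continuous_on R R^o 0 T a) ->
  (forall t, 0 <= t -> (0 <= G t)%E) ->
  (\int[mu]_(t in `[0%R, +oo[) G t < +oo)%E ->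
  {ae mu, forall t, 0 < t -> derivable a t 1 /\ ((derive1 a t)%:E <= G t)%E} ->
  exists (F : R -> R) (C : R), [/\
    forall s t, s <= t -> F s <= F t,
    forall t, 0 <= F t <= C &
    forall s t, 0 <= s -> s <= t -> a t - a s <= F t - F s].
Proof.
move=> ac aAC G0 Goo [N [mN N0 NP]].
pose D := `]0%R, +oo[ `\` N.
have mD : measurable D by exact: measurableD.
have DP t : D t -> derivable a t 1 /\ ((derive1 a t)%:E <= G t)%E.
  move=> [t0 nN]; apply: contrapT => ndt; apply: nN; apply: NP => /(_ _)/ndt; apply.
  by move: t0; rewrite /= in_itv/= andbT.
(* Off D, where a may not be derivable, g is set to 0; this leaves g
   measurable and below G everywhere. *)
pose g := (fun t => Num.max 0 (derive1 a t)) \_ D.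
have mg : measurable_fun setT g.
  apply/(measurable_restrictT _ _).1 => //.
  apply: measurable_maxr => //.
  by apply: measurable_derive1 => // t /DP[].
have g0 t : 0 <= g t.
  by rewrite /g patchE; case: ifPn => // _; rewrite le_max lexx.
have intg : (\int[mu]_t (g t)%:E < +oo)%E.
  apply: le_lt_trans Goo; rewrite [leRHS]integral_mkcond.
  apply: le_lower_integral => t _; first by rewrite lee_fin.
  rewrite /g !patchE; case: ifPn => [/set_mem Dt|_]; last first.
    by case: ifPn => // /set_mem; rewrite /= in_itv/= andbT; exact: G0.
  have [_ dG] := DP t Dt; move: Dt => [] /=; rewrite in_itv/= andbT => t0 _.
  rewrite mem_set/=; last by rewrite in_itv/= andbT ltW.
  by rewrite EFin_max ge_max dG andbT G0// ltW.
have ig : mu.-integrable setT (EFin \o g).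
  apply/integrableP; split; first exact/measurable_EFinP.
  by under eq_integral do rewrite /= ger0_norm//.
have igS (A : set R) : measurable A -> mu.-integrable A (EFin \o g).
  by move=> mA; apply: integrableS ig.
pose F t := (\int[mu]_(s in `[0%R, t]) g s)%R.
have subint (A B : set R) : measurable A -> measurable B -> A `<=` B ->
    (\int[mu]_(s in A) g s <= \int[mu]_(s in B) g s)%R.
  move=> mA mB AB; rewrite fine_le//.
  - by apply: integrable_fin_num => //; exact: igS.
  - by apply: integrable_fin_num => //; exact: igS.
  - apply: ge0_subset_integral => //.
    + by apply/measurable_EFinP; exact: measurable_funS mg.
    + by move=> t _; rewrite lee_fin.
exists F, (\int[mu]_t g t)%R; split.
- move=> s t st; apply: subint => // x /=; rewrite !in_itv/=; lra.
- by move=> t; rewrite Rintegral_ge0//= subint.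
have Fmono s t : s <= t -> F s <= F t.
  by move=> st; apply: subint => // x /=; rewrite !in_itv/=; lra.
move=> s t s0 st.
suff : a t - F t <= a s - F s by lra.
apply: (ae_derivative_le0_nonincreasing (f := fun t => a t - F t)) => //.
  move=> e e0; have [|dl dl0 dlP] := aAC t _ e e0; first lra.
  exists dl => // n u v uv dis sd.
  apply: le_lt_trans (dlP n u v _ dis sd); last first.
    by move=> i; have [? []] := uv i; split=> //; lra.
  apply: ler_sum => i _; have [_ [+ _]] := uv i => /Fmono.
  by have := ler_norm (a (v i) - a (u i)); lra.
have FTC : {ae mu, forall x, 0 < x -> derivable F x 1 /\ derive1 F x = g x}.
  have ig0 y : mu.-integrable [set` Interval (BLeft 0) (BRight y)] (EFin \o g) by exact: igS.
  have := FTC1 ig0 (open_integrable_locally openT ig).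
  apply: filterS; first exact: (ae_filter_ringOfSetsType mu).
  by move=> x /= Fx x0; apply: Fx; rewrite lte_fin.
have aeD : {ae mu, forall x, 0 < x -> D x}.
  exists N; split => // x /= nD; apply: contrapT => nN; apply: nD => x0; split => //.
  by rewrite /= in_itv/= x0.
move: FTC aeD; apply: filterS2; first exact: (ae_filter_ringOfSetsType mu).
move=> x Fx Dx sx xt.
have x0 : 0 < x by lra.
have [dF F'] := Fx x0; have [da _] := DP x (Dx x0).
split; first exact: derivableB.
rewrite derive1E deriveB// -!derive1E F' /g patchE mem_set; last exact: Dx.
by rewrite subr_le0 le_max lexx orbT.
Qed.
Corollary ae_integrable_derivative_bounded (a : R -> R) (G : R -> \bar R) :
  continuous a ->
  (forall T, 0 <= T -> @absolutely_continuous_on R R^o 0 T a) ->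
  (forall t, 0 <= t -> (0 <= G t)%E) ->
  (\int[mu]_(t in `[0%R, +oo[) G t < +oo)%E ->
  {ae mu, forall t, 0 < t -> derivable a t 1 /\ ((derive1 a t)%:E <= G t)%E} ->
  exists C, forall t, 0 <= t -> a t <= C.
Proof.
move=> ac aAC G0 Goo da.
have [F [C [_ F0C aF]]] := integrable_majorant ac aAC G0 Goo da.
exists (a 0 + C) => t t0; have := aF 0 t (lexx _) t0.
by have /andP[] := F0C 0; have /andP[] := F0C t; lra.
Qed.

Corollary ae_integrable_derivative_cvg (a : R -> R) (G : R -> \bar R) (m : R) :
  continuous a ->
  (forall T, 0 <= T -> @absolutely_continuous_on R R^o 0 T a) ->
  (forall t, 0 <= t -> (0 <= G t)%E) ->
  (\int[mu]_(t in `[0%R, +oo[) G t < +oo)%E ->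
  {ae mu, forall t, 0 < t -> derivable a t 1 /\ ((derive1 a t)%:E <= G t)%E} ->
  (forall t, 0 <= t -> m <= a t) ->
  exists c : R, a t @[t --> +oo] --> c.
Proof.
move=> ac aAC G0 Goo da ma.
have [F [C [Fmono F0C aF]]] := integrable_majorant ac aAC G0 Goo da.
have [c1 Fc1] : exists c : R, F t @[t --> +oo] --> c.
  apply: (@nondecreasing_halfline_cvg _ C) => [s t _|t _]; first exact: Fmono.
  by have /andP[] := F0C t.
have [c2 bc2] : exists c : R, F t - a t @[t --> +oo] --> c.
  apply: (@nondecreasing_halfline_cvg _ (C - m)) => [s t s0 st|t t0].
    by have := aF s t s0 st; lra.
  by have /andP[_] := F0C t; have := ma t t0; lra.
exists (c1 - c2); rewrite (_ : a = fun t => F t - (F t - a t)); first exact: cvgB.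
by apply/funext => t; lra.
Qed.

End Majorant.

(** * The Bochner integral and the scalar product *)

Section BochnerDot.
Context (R : realType) (H : completeNormedModType R).
Variables (dot : {dot H for (@idfun R)}) (hdot : induces_norm dot).
Context (d : measure_display) (T : measurableType d).
Variable mu : {measure set T -> \bar R}.

Lemma dot_simple_fun (s : simple_map H mu) (y : H) (t : T) :
  dot (simple_fun s t) y =
  \sum_i (\1_(simple_cell (s := s) i) t : R) * dot (simple_value i) y.
Proof.
by rewrite /simple_fun linear_sumlz; apply: eq_bigr => i _ /=; rewrite dotZl.
Qed.

Lemma integrable_cell (s : simple_map H mu) (D : set T) i (c : R) : measurable D ->
  mu.-integrable D (fun t => (c * \1_(simple_cell (s := s) i) t)%:E).
Proof.
move=> mD; under eq_fun do rewrite EFinM.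
apply: integrableZl => //; apply/integrableP; split.
  by apply/measurable_EFinP; apply: measurable_indic; exact: simple_measurable.
under eq_integral do rewrite gee0_abs ?lee_fin//.
rewrite integral_indic//; last exact: simple_measurable.
apply: le_lt_trans (simple_finite i); apply: le_measure; rewrite ?inE.
- by apply: measurableI => //; exact: simple_measurable.
- exact: simple_measurable.
- exact: subIsetl.
Qed.

Lemma dot_simple_funE (s : simple_map H mu) (y : H) :
  EFin \o (fun t => dot (simple_fun s t) y) =
  fun t => (\sum_i (dot (simple_value i) y * \1_(simple_cell (s := s) i) t)%:E)%E.
Proof.
apply/funext => t /=; rewrite dot_simple_fun sumEFin; congr EFin.
by apply: eq_bigr => i _; rewrite mulrC.
Qed.

Lemma integrable_dot_simple (s : simple_map H mu) (D : set T) (y : H) :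
  measurable D -> mu.-integrable D (EFin \o fun t => dot (simple_fun s t) y).
Proof.
move=> mD; rewrite dot_simple_funE; apply: integrable_sum => // i _.
exact: integrable_cell.
Qed.

Lemma dot_simple_integral (s : simple_map H mu) (D : set T) (y : H) : measurable D ->
  dot (simple_integral D s) y = (\int[mu]_(t in D) dot (simple_fun s t) y)%R.
Proof.
move=> mD; rewrite /Rintegral; have := dot_simple_funE s y; rewrite /comp => ->.
rewrite integral_sum//; last by move=> i; exact: integrable_cell.
rewrite linear_sumlz -sum_fine; last first.
  by move=> i _; apply: integrable_fin_num => //; exact: integrable_cell.
apply: eq_bigr => i _; rewrite /= dotZl mulrC.
rewrite -[X in X * fine _]/(fine (dot _ y)%:E).
have fincell : mu (simple_cell (s := s) i `&` D) \is a fin_num.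
  rewrite ge0_fin_numE//; apply: le_lt_trans (simple_finite i).
  apply: le_measure; rewrite ?inE; [|exact: simple_measurable|exact: subIsetl].
  by apply: measurableI => //; exact: simple_measurable.
rewrite -fineM//; congr fine; rewrite -integral_indic//; last exact: simple_measurable.
rewrite -integralZl//.
have := integrable_cell (s := s) i 1 mD; apply: eq_integrable => // t _.
by rewrite mul1r.
Qed.

(** This holds for simple maps by linearity of the integral; it passes to the
limit since |<f - s_n, y>| <= |y| |f - s_n|. *)
Lemma dot_bochner (D : set T) (f : T -> H) (I y : H) : measurable D ->
  mu.-integrable D (EFin \o fun t => dot (f t) y) ->
  is_bochner_integral mu D f I ->
  dot I y = (\int[mu]_(t in D) dot (f t) y)%R.
Proof.
move=> mD fi [s [_ sf sI]].
have c1 : dot (simple_integral D (s n)) y @[n --> \oo] --> dot I y.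
  by apply: cvg_dot => //; exact: cvg_cst.
apply: (cvg_unique (@Rhausdorff R) c1).
(* |f - s_n| may not be measurable, and its integral need not commute with
   multiplication by |y|; the constant is moved to the other side, where the
   integrand |<f - s_n, y>| is measurable.  The 1 covers the case y = 0. *)
pose k := (1 + `|y|)^-1.
have k0 : 0 < k by rewrite invr_gt0 ltr_pwDl.
apply/cvgrPdist_lt => e e0.
have ke0 : (0 < (k * e)%:E)%E by rewrite lte_fin mulr_gt0.
have : \forall n \near \oo, (\int[mu]_(t in D) `|f t - simple_fun (s n) t|%:E < (k * e)%:E)%E.
  exact: (sf _ (open_ereal_lt' ke0)).
apply: filterS => n sfn.
rewrite dot_simple_integral// -RintegralB//; last exact: integrable_dot_simple.
have gi : mu.-integrable D (EFin \o fun t => dot (f t) y - dot (simple_fun (s n) t) y).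
  have := integrableB mD fi (integrable_dot_simple (s n) y mD).
  by apply: eq_integrable.
rewrite -(ltr_pM2l k0) -lte_fin; apply: le_lt_trans sfn.
rewrite EFinM EFin_normr_Rintegral//.
apply: (@le_trans _ _ (k%:E * \int[mu]_(t in D) `|(dot (f t) y - dot (simple_fun (s n) t) y)%:E|)%E).
  rewrite lee_pmul2l// ?lte_fin//; apply: le_abse_integral => //.
  by case/integrableP : gi.
rewrite -ge0_integralZl//; last 2 first.
  - by apply: measurableT_comp => //; case/integrableP : gi.
  - by rewrite lee_fin ltW.
apply: le_lower_integral => t Dt; first by rewrite -EFinM lee_fin mulr_ge0// ltW.
rewrite -EFinM lee_fin -linearBl ler_pdivrMl; last by rewrite ltr_pwDl.
apply: le_trans (cauchy_schwarz hdot _ _) _.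
by rewrite mulrC ler_wpM2r// lerDr.
Qed.

End BochnerDot.

Section BochnerExists.
Context (R : realType) (H : completeNormedModType R).
Variables (dot : {dot H for (@idfun R)}) (hdot : induces_norm dot).
Notation mu := (@lebesgue_measure R).

Definition grid_cell (n N : nat) (i : 'I_N) : set R :=
  `[i%:R / n.+1%:R, i.+1%:R / n.+1%:R[.

Lemma measurable_grid_cell n N (i : 'I_N) : measurable (grid_cell n i).
Proof. exact: measurable_itv. Qed.

Lemma finite_grid_cell n N (i : 'I_N) : (mu (grid_cell n i) < +oo)%E.
Proof.
by rewrite /grid_cell lebesgue_measure_itv/=; case: ifPn => // _; rewrite -EFinB ltry.
Qed.

Definition step_map (f : R -> H) (n N : nat) : simple_map H mu :=
  @SimpleMap R H _ _ mu N (@grid_cell n N) (fun i : 'I_N => f (i%:R / n.+1%:R)) (@measurable_grid_cell n N)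
    (@finite_grid_cell n N).

Lemma step_mapE (f : R -> H) (n N : nat) (t : R) : 0 <= t -> t * n.+1%:R < N%:R ->
  simple_fun (step_map f n N) t = f ((Num.trunc (t * n.+1%:R))%:R / n.+1%:R).
Proof.
move=> t0 tN; set k := Num.trunc _.
have n0 : 0 < n.+1%:R :> R by [].
have /andP[kt tk] : k%:R <= t * n.+1%:R < k.+1%:R.
  by apply: truncn_itv; rewrite mulr_ge0.
have kN : (k < N)%N by rewrite -(ltr_nat R); exact: le_lt_trans tN.
rewrite /simple_fun /= (bigD1 (Ordinal kN))//= big1 => [|i ik].
  rewrite addr0 indicE mem_set ?scale1r//.
  by rewrite /grid_cell /= in_itv/= ler_pdivrMr// ltr_pdivlMr// kt.
rewrite indicE memNset ?scale0r// /grid_cell /= in_itv/= ler_pdivrMr// ltr_pdivlMr//.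
move=> /andP[it ti]; move/eqP: ik; apply; apply: val_inj => /=.
apply/eqP; rewrite eqn_leq -(ltnS i k) -(ltnS k i) -!(ltr_nat R).
by rewrite (le_lt_trans it tk) (le_lt_trans kt ti).
Qed.

Lemma grid_dist (n : nat) (t : R) : 0 <= t ->
  let s := (Num.trunc (t * n.+1%:R))%:R / n.+1%:R in
  [/\ 0 <= s, s <= t & t - s < n.+1%:R^-1].
Proof.
move=> t0 s; have n0 : 0 < n.+1%:R :> R by [].
have /andP[kt tk] : (Num.trunc (t * n.+1%:R))%:R <= t * n.+1%:R < (Num.trunc (t * n.+1%:R)).+1%:R.
  by apply: truncn_itv; rewrite mulr_ge0.
split; first by rewrite /s divr_ge0.
  by rewrite /s ler_pdivrMr.
rewrite -(ltr_pM2r n0) mulrBl /s divfK ?mulVf ?gt_eqF//.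
by move: tk; rewrite -natr1; lra.
Qed.

Definition uniformly_continuous_on (D : set R) (f : R -> H) := forall e, 0 < e ->
  exists2 delta, 0 < delta & forall s t, D s -> D t -> `|s - t| < delta ->
    `|f s - f t| < e.

Lemma uniformly_continuous_within (D : set R) f : uniformly_continuous_on D f ->
  {within D, continuous f}.
Proof.
move=> uf; apply/subspace_continuousP => t Dt; apply/cvgrPdist_lt => e /uf[dl dl0 fd].
rewrite near_withinE; apply/nbhs_ballP; exists dl => //= s ts Ds; exact: fd.
Qed.

(** The step maps of mesh 1 / (n + 1) converge to f uniformly on [0, T].  The
candidate integral I is the vector representing y |-> \int <f, y>; the
difference w between the integral of a step map and I satisfies
|w|^2 = \int <s_n - f, w> <= e T |w|. *)
Lemma uniformly_continuous_bochner (T : R) (f : R -> H) : 0 <= T ->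
  uniformly_continuous_on `[0, T] f ->
  exists I, is_bochner_integral mu `[0, T] f I.
Proof.
move=> T0 uf; pose D := `[0, T]%classic : set R.
have mD : measurable (D : set (measurableTypeR R)) by exact: measurable_itv.
have muD : mu D = T%:E.
  by rewrite lebesgue_measure_itv/= lte_fin; case: ltP => [_|?]; rewrite ?oppr0 ?adde0//;
    congr EFin; lra.
have fc := uniformly_continuous_within uf.
have intf y : mu.-integrable D (EFin \o fun t => dot (f t) y).
  apply: continuous_compact_integrable; first exact: segment_compact.
  move=> t; apply: cvg_dot => //; first exact: fc.
  exact: cvg_cst.
have intn : mu.-integrable D (EFin \o fun t => `|f t|).
  apply: continuous_compact_integrable; first exact: segment_compact.
  by move=> t; apply: cvg_norm; exact: fc.
(* Enough cells to cover [0, T], the point T included. *)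
pose N n := (n.+1 * (Num.trunc T).+1)%N.
pose s n := step_map f n (N n).
have close e : 0 < e -> \forall n \near \oo, forall t, D t -> `|f t - simple_fun (s n) t| < e.
  move=> e0; have [dl dl0 fd] := uf e e0.
  have /cvgrPdist_lt/(_ _ dl0) := @cvg_harmonic R; apply: filterS => n.
  rewrite sub0r normrN /harmonic ger0_norm ?invr_ge0// => nd t Dt.
  have : t \in `[0, T] by []; rewrite in_itv/= => /andP[t0 tT].
  rewrite step_mapE//; last first.
    rewrite /N natrM mulrC ltr_pM2l//; apply: le_lt_trans tT _.
    by have /andP[] := truncn_itv T0.
  have [s0 st ts] := grid_dist n t0.
  apply: fd => //.
    by rewrite /D /= in_itv/= s0/= (le_trans st).
  by rewrite ger0_norm ?subr_ge0//; exact: lt_trans nd.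
pose phi y := (\int[mu]_(t in D) dot (f t) y)%R.
have philin a y z : phi (a *: y + z) = a * phi y + phi z.
  have ia : mu.-integrable D (EFin \o fun t => a * dot (f t) y).
    have := integrableZl mD a (intf y); apply: eq_integrable => // t _ /=.
  rewrite /phi -RintegralZl//.
  rewrite -RintegralD//.
  by apply: eq_Rintegral => t _; rewrite linearDr /= dotZr.
have phibd y : `|phi y| <= (\int[mu]_(t in D) `|f t|)%R * `|y|.
  apply: le_trans (le_normr_Rintegral mD (intf y)) _.
  rewrite -RintegralZr//; apply: le_Rintegral => //.
  - by move/integrable_norm : (intf y).
  - exact: (integrableZr mD `|y| intn).
  - by move=> t _; exact: cauchy_schwarz.
have [I IP] := riesz hdot philin phibd.
have eT e : 0 < e -> e / (1 + T) * T < e.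
  by move=> e0; rewrite mulrAC ltr_pdivrMr; [nra|lra].
exists I; exists s; split.
- apply: aeW => t Dt; apply/cvgrPdist_lt => e e0.
  by apply: filterS (close e e0) => n; apply.
- pose E n := (\int[mu]_(t in D) `|f t - simple_fun (s n) t|%:E)%E.
  have E0 n : (0 <= E n)%E by apply: integral_ge0 => t _; rewrite lee_fin.
  have Ebd e n : (forall t, D t -> `|f t - simple_fun (s n) t| < e) -> (E n <= (e * T)%:E)%E.
    move=> ce; rewrite EFinM -muD -(integral_cst mu mD e%:E).
    apply: le_lower_integral => t Dt; rewrite lee_fin//.
    exact/ltW/ce.
  apply/fine_cvgP; split.
    apply: filterS (close 1 ltr01) => n /Ebd E1.
    by rewrite ge0_fin_numE ?E0//; apply: le_lt_trans E1 (ltry _).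
  apply/cvgrPdist_lt => e e0.
  have e1 : 0 < e / (1 + T) by rewrite divr_gt0//; lra.
  apply: filterS (close _ e1) => n /Ebd En.
  rewrite /= sub0r normrN ger0_norm ?fine_ge0 ?E0//.
  apply: le_lt_trans (eT e e0); rewrite -lee_fin fineK//.
  by rewrite ge0_fin_numE ?E0//; apply: le_lt_trans En (ltry _).
- apply/cvgrPdist_lt => e e0.
  have e1 : 0 < e / (1 + T) by rewrite divr_gt0//; lra.
  apply: filterS (close _ e1) => n cn; rewrite distrC.
  apply: le_lt_trans (eT e e0).
  set w := @simple_integral _ _ _ _ mu D (s n) - I.
  have [->|w0] := eqVneq w 0; first by rewrite normr0 mulr_ge0// ltW.
  have {}w0 : 0 < `|w| by rewrite normr_gt0.
  rewrite -(ler_pM2r w0) -expr2 hdot {1}/w linearBl /= -IP /phi.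
  have ints := @integrable_dot_simple R H dot _ _ mu (s n) D w mD.
  rewrite (dot_simple_integral dot)// -RintegralB//.
  apply: (@le_trans _ _ (\int[mu]_(t in D) (e / (1 + T) * `|w|))%R).
    apply: le_Rintegral => //.
    + by have := integrableB mD ints (intf w); apply: eq_integrable.
    + apply: (@continuous_compact_integrable R (cst (e / (1 + T) * `|w|))).
        exact: segment_compact.
      by apply: continuous_subspaceT => t; exact: cvg_cst.
    + move=> t Dt; rewrite -linearBl; apply: le_trans (ler_norm _) _.
      apply: le_trans (cauchy_schwarz hdot _ _) _.
      by rewrite ler_wpM2r// distrC ltW// cn.
  by rewrite Rintegral_cst// [X in _ * X](_ : _ = T) 1?mulrAC//; exact: (congr1 fine muD).
Qed.

End BochnerExists.

(** * Primitives, Cesaro means and absolute continuity *)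

Lemma clip_dist (R : realDomainType) (s t : R) :
  `|Num.max 0 t - Num.max 0 s| <= `|t - s|.
Proof.
rewrite ler_norml; case: (leP 0 t) => ?; case: (leP 0 s) => ?; have := ler_norm (t - s);
  have := ler_norm (s - t); rewrite (distrC s) => ? ?; apply/andP; split; lra.
Qed.

Section Primitive.
Context (R : realType).
Notation mu := (@lebesgue_measure R).

Definition primitive (q : R -> R) (t : R) : R := (\int[mu]_(s in `[0%R, t]) q s)%R.

Variables (q : R -> R) (qc : continuous q).

Lemma integrable_segment (s t : R) : mu.-integrable `[s, t] (EFin \o q).
Proof.
apply: continuous_compact_integrable; first exact: segment_compact.
exact: continuous_subspaceT.
Qed.

Lemma primitive_le0 t : t <= 0 -> primitive q t = 0.
Proof.
move=> t0; have [->|tn] := eqVneq t 0.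
  by rewrite /primitive set_itv1 Rintegral_set1.
rewrite /primitive set_itv_ge ?Rintegral_set0// bnd_simp -ltNge.
by rewrite lt_neqAle tn.
Qed.

Lemma derive_primitive t : 0 < t ->
  derivable (primitive q) t 1 /\ derive1 (primitive q) t = q t.
Proof.
move=> t0; apply: (@continuous_FTC1_closed R q 0 t (t + 1)) => //.
- by rewrite ltrDl.
- exact: integrable_segment.
- exact: qc.
Qed.

Lemma primitive_bounds (m M s t : R) : 0 <= s -> s <= t ->
  (forall r, s <= r -> r <= t -> m <= q r <= M) ->
  m * (t - s) <= primitive q t - primitive q s <= M * (t - s).
Proof.
move=> s0 st qmM.
have -> : primitive q t - primitive q s = (\int[mu]_(r in `[s, t]) q r)%R.
  rewrite /primitive -(Rintegral_itv_obnd_cbnd (r := s)); last first.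
    by apply: integrableS (integrable_segment s t) => //; exact: subset_itv_oc_cc.
  have := @Rintegral_itvB R q (BLeft 0) (BRight t) s (integrable_segment 0 t).
  by apply; rewrite bnd_simp.
have mE : mu `[s, t] = (t - s)%:E.
  rewrite lebesgue_measure_itv/= lte_fin; case: ltP => // ts.
  by congr EFin; lra.
have cstE c : (\int[mu]_(r in `[s, t]) c)%R = c * (t - s).
  by rewrite Rintegral_cst//= mE.
have icst c : mu.-integrable `[s, t] (EFin \o cst c).
  apply: continuous_compact_integrable; first exact: segment_compact.
  by apply: continuous_subspaceT => x; exact: cvg_cst.
rewrite -!cstE; apply/andP; split; apply: le_Rintegral => //; try exact: icst;
  try exact: integrable_segment.
  all: by move=> r /=; rewrite in_itv/= => /andP[sr rt]; have /andP[] := qmM r sr rt.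
Qed.

Lemma continuous_bounded_segment (T : R) : exists2 M, 0 <= M &
  forall r, 0 <= r -> r <= T -> `|q r| <= M.
Proof.
have [T0|T0] := leP 0 T; last by exists 0 => // r r0 rT; exfalso; lra.
have [|c _ cP] := @EVT_max R (fun r => `|q r|) 0 T T0.
  by apply: continuous_subspaceT => x; apply: cvg_norm; exact: qc.
by exists `|q c| => // r r0 rT; apply: cP; rewrite in_itv/= r0.
Qed.

Lemma primitive_lipschitz (T : R) : exists2 M, 0 <= M &
  forall s t, 0 <= s -> s <= t -> t <= T -> `|primitive q t - primitive q s| <= M * (t - s).
Proof.
have [M M0 qM] := continuous_bounded_segment T.
exists M => // s t s0 st tT; rewrite ler_norml -mulNr; apply: primitive_bounds => // r sr rt.
by rewrite -ler_norml; apply: qM; lra.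
Qed.

(** Beyond some T the integrand is within e / 2 of l, so the primitive differs
from l t by at most a constant plus e / 2 (t - T). *)
Lemma primitive_cesaro (l : R) : q t @[t --> +oo] --> l ->
  t^-1 * primitive q t @[t --> +oo] --> l.
Proof.
move=> /cvgrPdist_lt ql; apply/cvgrPdist_lt => e e0.
have e2 : 0 < e / 2 by rewrite divr_gt0.
have [T0 [_ T0P]] := ql _ e2.
(* T > 0 is needed by the bounds on the primitive; T > T0 by the choice of T0. *)
pose T := Num.max 1 (T0 + 1).
have T1 : 1 <= T by rewrite le_max lexx.
have TT0 : T0 < T by rewrite lt_max; apply/orP; right; lra.
pose B := `|primitive q T - l * T|.
exists (Num.max T (2 * B / e)); split; first exact: num_real.
move=> t; rewrite gt_max => /andP[Tt Bt].
have t0 : 0 < t by lra.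
have /andP[lo hi] : (l - e / 2) * (t - T) <= primitive q t - primitive q T <= (l + e / 2) * (t - T).
  apply: primitive_bounds; [lra|lra|move=> r Tr rt].
  have : `|l - q r| < e / 2 by apply: T0P; lra.
  by rewrite ltr_norml => /andP[? ?]; apply/andP; split; lra.
have : primitive q T - l * T <= B by exact: ler_norm.
have : - (primitive q T - l * T) <= B by rewrite /B -normrN; exact: ler_norm.
move: Bt; rewrite ltr_pdivrMr// => Bt B1 B2.
have -> : l - t^-1 * primitive q t = (l * t - primitive q t) / t.
  by field; rewrite gt_eqF.
rewrite normrM [`|t^-1|]ger0_norm ?invr_ge0 ?ltW// ltr_pdivrMr// ltr_norml.
have : e / 2 * (t - T) < e / 2 * t by rewrite ltr_pM2l//; lra.
by move=> h; apply/andP; split; lra.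
Qed.

(** The primitive vanishes on the negative half-line and is Lipschitz on every
segment of the positive one. *)
Lemma continuous_primitive : continuous (primitive q).
Proof.
move=> t; have [M M0 MP] := primitive_lipschitz (Num.max 0 (t + 1)).
have clip s : primitive q s = primitive q (Num.max 0 s).
  by case: (leP 0 s) => // s0; rewrite !primitive_le0// ltW.
have lip s : s < t + 1 -> `|primitive q t - primitive q s| <= M * `|t - s|.
  move=> st; rewrite (clip t) (clip s).
  apply: (@le_trans _ _ (M * `|Num.max 0 t - Num.max 0 s|)); last first.
    by rewrite ler_wpM2l// clip_dist.
  have [st'|ts'] := leP (Num.max 0 s) (Num.max 0 t).
    rewrite [`|Num.max 0 t - _|]ger0_norm ?subr_ge0//; apply: MP => //; first by rewrite le_max lexx.
    by rewrite ge_max !le_max lexx/=; apply/orP; right; lra.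
  rewrite distrC [`|Num.max 0 t - _|]distrC [`|Num.max 0 s - _|]ger0_norm; last first.
    by rewrite subr_ge0 ltW.
  apply: MP; [by rewrite le_max lexx|exact: ltW|].
  by rewrite ge_max !le_max lexx/=; apply/orP; right; lra.
apply/cvgrPdist_lt => e e0.
have d0 : 0 < Num.min 1 (e / (M + 1)) by rewrite lt_min ltr01 divr_gt0//; lra.
apply/nbhs_ballP; exists (Num.min 1 (e / (M + 1))) => //= s.
rewrite /ball/= lt_min => /andP[ts1 tse].
apply: le_lt_trans (lip s _) _.
  by move: ts1; rewrite ltr_norml; lra.
move: tse; rewrite ltr_pdivlMr; last lra.
by apply: le_lt_trans; rewrite mulrC ler_wpM2l//; lra.
Qed.

End Primitive.

Lemma primitive_cst (R : realType) (c t : R) : 0 <= t -> primitive (cst c) t = c * t.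
Proof.
move=> t0; have cc : continuous (cst c : R -> R) by move=> s; exact: cvg_cst.
have /andP[] := primitive_bounds cc (m := c) (M := c) (lexx 0) t0
  (fun r _ _ => introT andP (conj (lexx c) (lexx c))).
by rewrite (primitive_le0 _ (lexx 0)); lra.
Qed.

Lemma primitiveB (R : realType) (f g : R -> R) (t : R) : continuous f -> continuous g ->
  primitive (fun s => f s - g s) t = primitive f t - primitive g t.
Proof.
by move=> fc gc; rewrite /primitive RintegralB//; exact: integrable_segment.
Qed.

Section AbsoluteContinuity.
Context (R : realType) (H : completeNormedModType R).

Lemma absolutely_continuous_uniform (T : R) (x : R -> H) :
  absolutely_continuous_on 0 T x -> uniformly_continuous_on `[0, T] x.
Proof.
move=> xAC e /xAC[dl dl0 xd]; exists dl => //.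
have key s t : 0 <= s -> s <= t -> t <= T -> t - s < dl -> `|x t - x s| < e.
  move=> s0 st tT tsd; have := xd 1%N (fun=> s) (fun=> t).
  rewrite !big_ord1; apply=> // i j; by rewrite !ord1 eqxx.
move=> s t /=; rewrite !in_itv/= => /andP[s0 sT] /andP[t0 tT] st.
have [st'|st'] := leP s t.
  by rewrite distrC; apply: key => //; move: st; rewrite ltr_norml; lra.
by apply: key => //; [exact: ltW|move: st; rewrite ltr_norml; lra].
Qed.

Lemma absolutely_continuous_dominated (T : R) (x : R -> H) (h : R -> R) (K M : R) :
  0 <= K -> 0 <= M -> absolutely_continuous_on 0 T x ->
  (forall u v, 0 <= u -> u <= v -> v <= T ->
     `|h v - h u| <= K * `|x v - x u| + M * (v - u)) ->
  @absolutely_continuous_on R R^o 0 T h.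
Proof.
move=> K0 M0 xAC hKM e e0.
have eK : 0 < e / 2 / (K + 1) by rewrite !divr_gt0//; lra.
have eM : 0 < e / 2 / (M + 1) by rewrite !divr_gt0//; lra.
have [dl dl0 xd] := xAC _ eK.
exists (Num.min dl (e / 2 / (M + 1))); first by rewrite lt_min dl0.
move=> n u v uv dis; rewrite lt_min => /andP[sd sM].
have := xd n u v uv dis sd; rewrite ltr_pdivlMr; last lra.
move: sM; rewrite ltr_pdivlMr; last lra.
set sx := \sum_i `|x (v i) - x (u i)|; set sl := \sum_i (v i - u i) => sM sK.
have sx0 : 0 <= sx by apply: sumr_ge0.
have sl0 : 0 <= sl by apply: sumr_ge0 => i _; have [_ [? _]] := uv i; lra.
apply: (@le_lt_trans _ _ (K * sx + M * sl)).
  rewrite !mulr_sumr -big_split /=; apply: ler_sum => i _.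
  by have [? [? ?]] := uv i; exact: hKM.
by rewrite mulrDr mulr1 in sM; rewrite mulrDr mulr1 in sK; lra.
Qed.

End AbsoluteContinuity.

(** * The Brezis-Haraux function of a maximal monotone operator *)

Section Monotone.
Context (R : realType) (H : completeNormedModType R).
Variable dot : {dot H for (@idfun R)}.

(** Otherwise (z, p) could be added to the graph of M. *)
Lemma maximal_monotone_mem (M : H -> set H) (z p : H) : maximal_monotone dot M ->
  (forall y v, M y v -> 0 <= dot (y - z) (v - p)) -> M z p.
Proof.
move=> [Mmono Mmax] zp; apply: contrapT => nMzp.
pose N (y : H) : set H := [set v | M y v \/ (y = z /\ v = p)].
apply: (Mmax N).
  move=> [y1 v1] [y2 v2]; rewrite /gph /= => -[M1|[-> ->]] [M2|[-> ->]].
  - exact: (Mmono (y1, v1) (y2, v2)).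
  - by rewrite -[z - y1]opprB -[p - v1]opprB linearNl linearNr /= opprK; exact: zp.
  - exact: zp.
  - by rewrite !subrr linear0l.
split; first by move=> [y v] /= Myv; left.
by move/(_ (z, p)) => /= h; apply/nMzp/h; right.
Qed.

Lemma brezis_haraux_ge (M : H -> set H) (x u y v : H) : M y v ->
  ((dot (x - y) (v - u))%:E <= brezis_haraux dot M x u)%E.
Proof. by move=> Myv; apply: ereal_sup_ubound; exists (y, v). Qed.

(** If the supremum were negative, then <y - z, v - p> >= 0 for all (y, v) in the
graph of M, so (z, p) would belong to it; but then the supremum is at least
<z - z, p - p> = 0. *)
Lemma brezis_haraux_ge0 (M : H -> set H) (z p : H) : maximal_monotone dot M ->
  (0 <= brezis_haraux dot M z p)%E.
Proof.
move=> Mmax; rewrite leNgt; apply/negP => G0.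
have Mzp : M z p.
  apply: maximal_monotone_mem => // y v Myv.
  have := le_lt_trans (brezis_haraux_ge z p Myv) G0; rewrite lte_fin.
  by rewrite -[z - y]opprB linearNl /= oppr_lt0 => /ltW.
have := le_lt_trans (brezis_haraux_ge z p Mzp) G0.
by rewrite !subrr linear0l ltxx.
Qed.

End Monotone.

(** * The energy of an absolutely continuous trajectory *)

Section Trajectory.
Context (R : realType) (H : completeNormedModType R).
Variables (dot : {dot H for (@idfun R)}) (hdot : induces_norm dot).
Notation mu := (@lebesgue_measure R).

Variable x : R -> H.
Hypothesis xAC : forall T, 0 <= T -> absolutely_continuous_on 0 T x.

(* A solution is prescribed on the positive half-line only; freezing it at x 0
   on the negative one makes it continuous on the whole line. *)
Let xt (t : R) := x (Num.max 0 t).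

Lemma clipped_continuous : continuous xt.
Proof.
move=> t; apply/cvgrPdist_lt => e e0.
have [|dl dl0 xd] := absolutely_continuous_uniform (xAC (T := `|t| + 1) _) e0.
  by rewrite addr_ge0.
apply/nbhs_ballP; exists (Num.min 1 dl); first by rewrite /= lt_min ltr01.
move=> s; rewrite /ball/= lt_min => /andP[ts1 tsd].
have tn := ler_norm t; have tn0 := normr_ge0 t; have := ts1; rewrite ltr_norml => /andP[ts2 ts3].
apply: xd.
- by rewrite /= in_itv/= le_max lexx/= ge_max; apply/andP; split; lra.
- by rewrite /= in_itv/= le_max lexx/= ge_max; apply/andP; split; lra.
- exact: le_lt_trans (clip_dist _ _) tsd.
Qed.

Lemma time_average_dot (y : H) (t : R) : 0 < t ->
  dot (time_average x t) y = t^-1 * primitive (fun s => dot (xt s) y) t.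
Proof.
move=> t0; rewrite /time_average dotZl; congr (_ * _).
have [I xI] := uniformly_continuous_bochner hdot (ltW t0)
  (absolutely_continuous_uniform (xAC (ltW t0))).
have qc : continuous (fun s => dot (xt s) y).
  by move=> s; apply: cvg_dot => //; [exact: clipped_continuous|exact: cvg_cst].
have eqx s : s \in `[0, t]%classic -> dot (x s) y = dot (xt s) y.
  by move/set_mem; rewrite /= in_itv/= => /andP[s0 _]; rewrite /xt max_r.
rewrite (@dot_bochner R H dot hdot _ _ mu `[0, t] x _ y).
- exact: eq_Rintegral.
- exact: measurable_itv.
- have := integrable_segment qc 0 t; apply: eq_integrable => // s /eqx /= ->//.
- by apply: xgetPex; exists I.
Qed.

(** The difference quotient of |.|^2 / 2 factors: with A and B the values of x - z
at t + h and t, (|A|^2 - |B|^2) / (2 h) = <(A - B) / h, (A + B) / 2>. *)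
Lemma derive_half_norm_sqr (z : H) (t : R) : 0 < t -> derivable x t 1 ->
  derivable (fun s => 2^-1 * `|xt s - z| ^+ 2) t 1 /\
  derive1 (fun s => 2^-1 * `|xt s - z| ^+ 2) t = dot (xt t - z) (derive1 x t).
Proof.
move=> t0 dx; apply: derivable_from_quotient; rewrite dotC.
have xq := cvg_difference_quotient dx.
have c1 : 2^-1 *: ((xt (t + h) - z) + (xt t - z)) @[h --> 0^'] --> xt t - z.
  rewrite [X in _ --> X](_ : _ = 2^-1 *: ((xt t - z) + (xt t - z))); last first.
    by rewrite scalerDr -scalerDl (_ : 2^-1 + 2^-1 = 1) ?scale1r//; lra.
  apply: cvgZ; first exact: cvg_cst.
  apply: cvgD; last exact: cvg_cst.
  apply: cvgB; last exact: cvg_cst.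
  have th : t + h @[h --> (0 : R)^'] --> t.
    by rewrite -[X in _ --> X]addr0; apply: cvgD; [exact: cvg_cst|exact: cvg_within].
  exact: (cvg_comp _ _ th (@clipped_continuous t)).
apply: cvg_trans (cvg_dot hdot (FF := _) xq c1); apply: near_eq_cvg.
rewrite near_withinE; apply/nbhs_ballP; exists t => //= h.
rewrite /ball /= sub0r normrN ltr_norml => /andP[h1 h2] hn0.
have -> : x (t + h) - x t = (xt (t + h) - z) - (xt t - z).
  rewrite /xt !max_r; [|exact: ltW|lra].
  by rewrite opprB addrA subrK.
move: (xt (t + h) - z) (xt t - z) => A B.
rewrite dotZl dotZr; congr (_ * _).
by rewrite !hdot linearDr /= !linearBl /= (dotC dot B A); ring.
Qed.

Lemma continuous_dot_clipped (z p : H) : continuous (fun s => dot (xt s - z) p).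
Proof.
move=> s; apply: cvg_dot => //; last exact: cvg_cst.
by apply: cvgB; [exact: clipped_continuous|exact: cvg_cst].
Qed.

(** Its derivative is <x - z, x' + p>, the quantity that the Brezis-Haraux
function of A_t at (z, p) bounds from above along a solution. *)
Definition energy (z p : H) (t : R) : R :=
  2^-1 * `|xt t - z| ^+ 2 + primitive (fun s => dot (xt s - z) p) t.

Lemma continuous_energy z p : continuous (energy z p).
Proof.
move=> t; apply: cvgD; last exact/continuous_primitive/continuous_dot_clipped.
apply: cvgM; first exact: cvg_cst.
have nc : `|xt s - z| @[s --> t] --> `|xt t - z|.
  by apply: cvg_norm; apply: cvgB; [exact: clipped_continuous|exact: cvg_cst].
exact: (cvgM nc nc).
Qed.

(** On [0, T], where x is bounded, the square of the norm is Lipschitz in x and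
the primitive is Lipschitz in t. *)
Lemma absolutely_continuous_energy z p (T : R) : 0 <= T ->
  @absolutely_continuous_on R R^o 0 T (energy z p).
Proof.
move=> T0; have [K K0 xK] : exists2 K, 0 <= K & forall r, 0 <= r -> r <= T -> `|xt r| <= K.
  have [|K K0 KP] := @continuous_bounded_segment R (fun r => `|xt r|) _ T.
    by move=> r; apply: cvg_norm; exact: clipped_continuous.
  by exists K => // r r0 rT; rewrite -[leLHS]normr_id; exact: KP.
have [M M0 MP] := primitive_lipschitz (@continuous_dot_clipped z p) T.
apply: (absolutely_continuous_dominated (K := K + `|z|) _ M0 (xAC T0)).
  by rewrite addr_ge0.
move=> u v u0 uv vT.
have -> : energy z p v - energy z p u = 2^-1 * (`|xt v - z| ^+ 2 - `|xt u - z| ^+ 2) +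
    (primitive (fun s => dot (xt s - z) p) v - primitive (fun s => dot (xt s - z) p) u).
  by rewrite /energy; ring.
apply: le_trans (ler_normD _ _) _; apply: lerD; last exact: MP.
have -> : x v - x u = (xt v - z) - (xt u - z).
  rewrite /xt !max_r; [|lra|lra].
  by rewrite opprB addrA subrK.
have An : `|xt v - z| <= K + `|z|.
  by apply: le_trans (ler_normB _ _) _; rewrite lerD2r; apply: xK; lra.
have Bn : `|xt u - z| <= K + `|z|.
  by apply: le_trans (ler_normB _ _) _; rewrite lerD2r; apply: xK; lra.
move: (xt v - z) (xt u - z) An Bn => A B An Bn.
have -> : `|A| ^+ 2 - `|B| ^+ 2 = dot (A - B) (A + B).
  by rewrite !hdot linearDr /= !linearBl /= (dotC dot B A); ring.
rewrite normrM ger0_norm; last by lra.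
have := cauchy_schwarz hdot (A - B) (A + B).
have : `|A - B| * `|A + B| <= `|A - B| * (2 * (K + `|z|)).
  by rewrite ler_wpM2l//; have := ler_normD A B; lra.
lra.
Qed.

Lemma derive_energy z p t : 0 < t -> derivable x t 1 ->
  derivable (energy z p) t 1 /\
  derive1 (energy z p) t = dot (xt t - z) (derive1 x t + p).
Proof.
move=> t0 dx; have [d1 e1] := derive_half_norm_sqr z t0 dx.
have [d2 e2] := derive_primitive (@continuous_dot_clipped z p) t0.
split; first exact: derivableD.
by rewrite derive1E deriveD// -!derive1E e1 e2 linearDr.
Qed.

Lemma time_average_subr_dot (z p : H) (t : R) : 0 < t ->
  dot (time_average x t - z) p = t^-1 * primitive (fun s => dot (xt s - z) p) t.
Proof.
move=> t0; rewrite linearBl /= time_average_dot//.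
have -> : (fun s => dot (xt s - z) p) = (fun s => dot (xt s) p - cst (dot z p) s).
  by apply/funext => s; rewrite linearBl.
rewrite primitiveB; last 2 first.
  - by move=> s; apply: cvg_dot => //; [exact: clipped_continuous|exact: cvg_cst].
  - by move=> s; exact: cvg_cst.
by rewrite primitive_cst ?ltW// mulrBr mulrCA mulVf ?mulr1// gt_eqF.
Qed.

End Trajectory.

(** * Asymptotic behaviour of the averages of a solution *)

Section Asymptotics.
Context (R : realType) (H : completeNormedModType R).
Variables (dot : {dot H for (@idfun R)}) (hdot : induces_norm dot).
Variables (A : R -> H -> set H) (Ainf : H -> set H) (x : R -> H).
Hypothesis hA : forall t : R, 0 <= t -> maximal_monotone dot (A t).
Hypothesis hAinf : maximal_monotone dot Ainf.
Hypothesis hG : forall z p : H, gph Ainf (z, p) ->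
  (\int[@lebesgue_measure R]_(t in `[0%R, +oo[) brezis_haraux dot (A t) z p < +oo)%E.
Hypothesis hx : strong_global_solution A x.

(** With u = - x' in A_t (x), the bound is the term (x, u) of the supremum
defining the Brezis-Haraux function. *)
Lemma ae_derive_energy_le (z p : H) :
  {ae (@lebesgue_measure R), forall t, 0 < t -> derivable (energy dot x z p) t 1 /\
    ((derive1 (energy dot x z p) t)%:E <= brezis_haraux dot (A t) z p)%E}.
Proof.
case: hx => xAC; apply: filterS; first exact: (ae_filter_ringOfSetsType (@lebesgue_measure R)).
move=> t xt t0; have [dx [u Au xu]] := xt t0.
have [dE eE] := derive_energy hdot xAC z p t0 dx.
split=> //; rewrite eE max_r; last exact: ltW.
apply: le_trans (brezis_haraux_ge dot z p Au); rewrite lee_fin.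
have -> : derive1 x t = - u by apply/eqP; rewrite -addr_eq0 xu.
by rewrite -[x t - z]opprB linearNl -linearNr /= opprD opprK.
Qed.

Lemma energy_bounded (z p : H) : Ainf z p ->
  exists C, forall t, 0 <= t -> energy dot x z p t <= C.
Proof.
move=> zp; apply: ae_integrable_derivative_bounded (hG zp) (ae_derive_energy_le z p).
- exact: (@continuous_energy R H dot hdot x hx.1 z p).
- by move=> T T0; exact: (absolutely_continuous_energy hdot hx.1 z p T0).
- by move=> t t0; exact/brezis_haraux_ge0/hA.
Qed.

Let X := time_average x.

(** Dividing by t the bound on the energy, whose quadratic part is nonnegative. *)
Lemma dot_average_le (z p : H) : Ainf z p ->
  exists C, forall t, 0 < t -> dot (X t - z) p <= C / t.
Proof.
move=> zp; have [C CP] := energy_bounded zp; exists C => t t0.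
have := CP t (ltW t0); rewrite /energy /X (time_average_subr_dot hdot hx.1)// => h.
rewrite mulrC ler_pM2r ?invr_gt0//; apply: le_trans h; rewrite lerDr.
by rewrite mulr_ge0// sqr_ge0.
Qed.

Lemma energy_zero (z : H) (t : R) : 0 <= t ->
  energy dot x z 0 t = 2^-1 * `|x t - z| ^+ 2.
Proof.
move=> t0; rewrite /energy max_r//.
have -> : (fun s => dot (x (Num.max 0 s) - z) 0) = cst 0.
  by apply/funext => s; rewrite linear0r.
by rewrite primitive_cst// mul0r addr0.
Qed.

(** The energy for p = 0 is half the squared distance to z. *)
Lemma trajectory_bounded (z : H) : Ainf z 0 ->
  exists2 K, 0 <= K & forall t, 0 <= t -> `|x t| <= K.
Proof.
move=> z0; have [C CP] := energy_bounded z0.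
exists (1 + 2 * C + `|z|).
  have := CP 0 (lexx _); rewrite energy_zero// => h.
  have := sqr_ge0 `|x 0 - z|; have := normr_ge0 z; lra.
move=> t t0; have := CP t t0; rewrite energy_zero// => h.
have := ler_normD (x t - z) z; rewrite subrK => h2.
(* r <= (1 + r^2) / 2 <= 1 + r^2 for r = |x t - z|, whose square is at most
   2 C. *)
have := sqr_ge0 (`|x t - z| - 1); rewrite sqrrB => h3.
have := normr_ge0 (x t - z); lra.
Qed.

Lemma distance_to_zeros_cvg (z : H) : Ainf z 0 ->
  exists c : R, `|x t - z| ^+ 2 @[t --> +oo] --> c.
Proof.
move=> z0; have [c cP] : exists c : R, energy dot x z 0 t @[t --> +oo] --> c.
  apply: (ae_integrable_derivative_cvg (m := 0) _ _ _ (hG z0) (ae_derive_energy_le z 0)).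
  - exact: (@continuous_energy R H dot hdot x hx.1 z 0).
  - by move=> T T0; exact: (absolutely_continuous_energy hdot hx.1 z 0 T0).
  - by move=> t t0; exact/brezis_haraux_ge0/hA.
  - by move=> t t0; rewrite energy_zero// mulr_ge0// sqr_ge0.
exists (2 * c).
have : 2 * energy dot x z 0 t @[t --> +oo] --> 2 * c by apply: cvgM cP; exact: cvg_cst.
apply: cvg_trans; apply: near_eq_cvg; exists 0; split => // t t0.
by rewrite energy_zero ?ltW// mulrA divff ?mul1r.
Qed.

(** |X t|^2 is the mean over [0, t] of <x s, X t>, at most K |X t|. *)
Lemma average_bounded (z : H) : Ainf z 0 ->
  exists K, forall t, 0 < t -> `|X t| <= K.
Proof.
move=> /trajectory_bounded[K K0 KP]; exists K => t t0.
have [->|Xn0] := eqVneq (X t) 0; first by rewrite normr0.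
have {}Xn0 : 0 < `|X t| by rewrite normr_gt0.
rewrite -(ler_pM2r Xn0) -expr2 hdot {1}/X (time_average_dot hdot hx.1)//.
have qc : continuous (fun s : R => dot (x (Num.max 0 s)) (X t)).
  move=> s; apply: cvg_dot => //; last exact: cvg_cst.
  exact: (clipped_continuous hx.1).
have qb r : 0 <= r -> r <= t ->
    - (K * `|X t|) <= dot (x (Num.max 0 r)) (X t) <= K * `|X t|.
  move=> r0 _; rewrite -ler_norml; apply: le_trans (cauchy_schwarz hdot _ _) _.
  by rewrite ler_wpM2r// max_r// KP.
have /andP[_] := primitive_bounds qc (lexx 0) (ltW t0) qb.
rewrite (primitive_le0 _ (lexx 0)) !subr0 => h.
by rewrite mulrC ler_pdivrMr.
Qed.

(** |x - b|^2 - |x - a|^2 = 2 <x, a - b> + |b|^2 - |a|^2 converges, so <x, a - b>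
converges, and its Cesaro mean is <X, a - b>. *)
Lemma average_dot_diff_cvg (a b : H) : Ainf a 0 -> Ainf b 0 ->
  exists c : R, dot (X t) (a - b) @[t --> +oo] --> c.
Proof.
move=> /distance_to_zeros_cvg[ca caP] /distance_to_zeros_cvg[cb cbP].
pose l := 2^-1 * (cb - ca + (`|a| ^+ 2 - `|b| ^+ 2)).
have ql : dot (x (Num.max 0 t)) (a - b) @[t --> +oo] --> l.
  have : 2^-1 * ((`|x t - b| ^+ 2 - `|x t - a| ^+ 2) + (`|a| ^+ 2 - `|b| ^+ 2)) @[t --> +oo] --> l.
    apply: cvgM; first exact: cvg_cst.
    by apply: cvgD; [exact: cvgB|exact: cvg_cst].
  apply: cvg_trans; apply: near_eq_cvg; exists 0; split => // t t0.
  by rewrite max_r ?ltW// linearBr /= !(norm_sqrB hdot); lra.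
exists l.
have qc : continuous (fun s : R => dot (x (Num.max 0 s)) (a - b)).
  move=> s; apply: cvg_dot => //; last exact: cvg_cst.
  exact: (clipped_continuous hx.1).
have := primitive_cesaro qc ql; apply: cvg_trans; apply: near_eq_cvg.
by exists 0; split => // t t0; rewrite /X (time_average_dot hdot hx.1).
Qed.

(** The inequality <X t - z, p> <= C / t passes to the limit as
<l - z, p> <= 0, that is <z - l, p - 0> >= 0 for all (z, p) in the graph of
Ainf; maximality applies. *)
Lemma average_cluster_zero (U : set_system R) (l : H) : UltraFilter U ->
  pinfty_nbhs R `<=` U -> (forall y, dot (X t) y @[t --> U] --> dot l y) ->
  Ainf l 0.
Proof.
move=> UU FU lP; apply: (maximal_monotone_mem hAinf) => z p zp.
have [C CP] := dot_average_le zp.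
rewrite subr0 -[z - l]opprB linearNl /= oppr_ge0 linearBl /= subr_le0.
have inv0 : t^-1 @[t --> U] --> (0 : R).
  have : t^-1 @[t --> +oo] --> (0 : R).
    by apply/gtr0_cvgV0; [exists 0; split|exact: cvg_id].
  by apply: cvg_trans; exact: cvg_app.
have bound : dot z p + C / t @[t --> U] --> dot z p + C * 0.
  by apply: cvgD; [exact: cvg_cst|apply: cvgM inv0; exact: cvg_cst].
rewrite -[leRHS]addr0 -(mulr0 C); apply: ler_cvg_to (lP p) bound _.
apply: FU; exists 0; split => // t t0.
by have := CP t t0; rewrite linearBl /=; lra.
Qed.

End Asymptotics.

Theorem theorem2p1 (R : realType) (H : completeNormedModType R)
    (dot : {dot H for (@idfun R)}) (hdot : induces_norm dot)
    (A : R -> H -> set H)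
    (hA : forall t : R, 0 <= t -> maximal_monotone dot (A t))
    (Ainf : H -> set H) (hAinf : maximal_monotone dot Ainf)
    (hS : zeros Ainf !=set0)
    (hG : forall z p : H, gph Ainf (z, p) ->
      (\int[@lebesgue_measure R]_(t in `[0%R, +oo[)
         brezis_haraux dot (A t) z p < +oo)%E)
    (x : R -> H) (hx : strong_global_solution A x) :
  exists2 xinf : H, zeros Ainf xinf & weakly_cvg_pinfty (time_average x) xinf.
Proof.
have [z z0] := hS.
have [K KP] := average_bounded hdot hA hG hx z0.
have [||l l0 lP] := @weak_cvg_unique_cluster R H dot hdot R (pinfty_nbhs R) _
  (time_average x) K (zeros Ainf) _ (average_cluster_zero hdot hA hAinf hG hx).
- by exists 0; split => // t; exact: KP.
- by move=> a b; exact: (average_dot_diff_cvg hdot hA hG hx).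
exists l => // phi phic.
have [C _ phiC] : exists2 C, True & forall y, `|phi y| <= C * `|y|.
  have /linear_boundedP[C [_ CP]] : bounded_near phi (nbhs 0).
    exact/linear_bounded_continuous.
  by exists (C + 1) => // y; apply: CP; rewrite ltrDl.
have [r rP] := riesz hdot (fun a y z => linearP phi a y z) phiC.
rewrite rP dotC; have := lP r; apply: cvg_trans; apply: near_eq_cvg; apply: nearW => t.
by rewrite rP dotC.
Qed.
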